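(* Let $K$ be a quadratic field with embeddings into $\mathbb{R}$ and $\mathbb{Q}_2$, and let $\alpha\in K\setminus\mathbb{Q}$. Let $\{\alpha_n\}_{n\ge0}$ be the sequence generated by the algorithm described in the context. Then there exist integers $0\le n_1<n_2$ such that $\alpha_{n_1}=\alpha_{n_2}$ and $n_1\equiv n_2\pmod 2$.
   Context: $K$ is a quadratic field with fixed field embeddings $\sigma_\infty:K\to\mathbb{R}$ and $\sigma_2:K\to\mathbb{Q}_2$. For $\alpha\in K$ write $\alpha_\infty=\sigma_\infty(\alpha)$, $\alpha_{\langle 2\rangle}=\sigma_2(\alpha)$. For $u=\sum_{n}c_n2^n\in\mathbb{Q}_2$ with digits $c_n\in\{0,1\}$ ($c_n=0$ for $n<v_2(u)$), put $\lfloor u\rfloor_2=\sum_{n\le 0}c_n2^n\in\mathbb{Z}[1/2]$. For $\alpha\in K$ let $b^{(0)}(\alpha)=2m+\lfloor\alpha_{\langle 2\rangle}\rfloor_2$, where $m$ is the smallest among the integers $i$ minimizing $|\alpha_\infty-2i-\lfloor\alpha_{\langle 2\rangle}\rfloor_2|$; let $b^{(1)}(\alpha)=m'+\lfloor\alpha_{\langle 2\rangle}\rfloor_2$, where $m'$ is the smallest among the integers $i$ minimizing $|\alpha_\infty-i-\lfloor\alpha_{\langle 2\rangle}\rfloor_2|$. For $\epsilon\in\{0,1\}$ let $F_{2,\epsilon}(\alpha)=\frac{1}{\alpha-b^{(\epsilon)}(\alpha)}$. Algorithm: $\alpha_0=\alpha$; for $n\ge0$, $\alpha_{n+1}=F_{2,0}(\alpha_n)$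 if $n$ is even and $\alpha_{n+1}=F_{2,1}(\alpha_n)$ if $n$ is odd (for $\alpha\in K\setminus\mathbb{Q}$ the algorithm never halts). *)

(* Defs.v *)
From HB Require Import structures.
From mathcomp Require Import all_boot all_order all_algebra all_field.
From mathcomp Require Import cyclic zify ring lra.
From mathcomp Require Import boolp classical_sets functions fsbigop reals.

Set Implicit Arguments.
Unset Strict Implicit.
Unset Printing Implicit Defensive.

Import Order.TTheory GRing.Theory Num.Theory.

Local Open Scope classical_set_scope.
Local Open Scope nat_scope.

(* The 2-adic integers, as the inverse limit of the rings Z/2^n: an element is
   the sequence of its residues modulo 2^n, each in {0, ..., 2^n - 1}. *)
Record Z2adic := MkZ2adic {
  res2 :> nat -> nat;
  res2P : forall n, res2 n.+1 %% 2 ^ n = res2 n }.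

HB.instance Definition _ := gen_eqMixin Z2adic.
HB.instance Definition _ := gen_choiceMixin Z2adic.

Section Z2adicRing.
Implicit Types x y z : Z2adic.

Lemma Z2adic_ext x y : (forall n, x n = y n) -> x = y.
Proof.
case: x y => x xP [y yP] /= /funext xy; subst y.
by congr MkZ2adic; apply: Prop_irrelevance.
Qed.

Lemma res2_mod x n : x n %% 2 ^ n = x n.
Proof. by rewrite -{1}res2P modn_mod res2P. Qed.

Lemma res2_modS n m : m %% 2 ^ n.+1 %% 2 ^ n = m %% 2 ^ n.
Proof. by rewrite modn_dvdm // dvdn_exp2l. Qed.

Lemma res2_modD x n k : x (n + k) %% 2 ^ n = x n.
Proof.
elim: k => [|k IH]; first by rewrite addn0 res2_mod.
by rewrite addnS -IH -[in RHS]res2P modn_dvdm // dvdn_exp2l // leq_addr.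
Qed.

Lemma of_nat2P (m n : nat) : (m %% 2 ^ n.+1) %% 2 ^ n = m %% 2 ^ n.
Proof. exact: res2_modS. Qed.
Definition of_nat2 (m : nat) := MkZ2adic (of_nat2P m).

Lemma add2P x y n :
  ((x n.+1 + y n.+1) %% 2 ^ n.+1) %% 2 ^ n = (x n + y n) %% 2 ^ n.
Proof. by rewrite res2_modS -modnDm !res2P. Qed.
Definition add2 x y := MkZ2adic (add2P x y).

Lemma mul2P x y n :
  ((x n.+1 * y n.+1) %% 2 ^ n.+1) %% 2 ^ n = (x n * y n) %% 2 ^ n.
Proof. by rewrite res2_modS -modnMm !res2P. Qed.
Definition mul2 x y := MkZ2adic (mul2P x y).

Lemma minus_one2P n : (2 ^ n.+1).-1 %% 2 ^ n = (2 ^ n).-1.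
Proof.
have n0 : 0 < 2 ^ n by rewrite expn_gt0.
rewrite expnS mul2n -addnn -(prednK n0) addSn /= -[X in _ + X]addn1.
by rewrite addn1 modnDr modn_small.
Qed.
Definition opp2 x := mul2 (MkZ2adic minus_one2P) x.

Lemma add2A : associative add2.
Proof. by move=> x y z; apply: Z2adic_ext => n /=; rewrite modnDml modnDmr addnA. Qed.

Lemma add2C : commutative add2.
Proof. by move=> x y; apply: Z2adic_ext => n /=; rewrite addnC. Qed.

Lemma add20 : left_id (of_nat2 0) add2.
Proof. by move=> x; apply: Z2adic_ext => n /=; rewrite modnDml res2_mod. Qed.

Lemma add2N : left_inverse (of_nat2 0) opp2 add2.
Proof.
move=> x; apply: Z2adic_ext => n /=; rewrite modnDml.
rewrite -[X in _ + X]mul1n -mulnDl addn1 prednK ?expn_gt0 //.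
by rewrite modnMr mod0n.
Qed.

HB.instance Definition _ := GRing.isZmodule.Build Z2adic add2A add2C add20 add2N.

Lemma mul2A : associative mul2.
Proof. by move=> x y z; apply: Z2adic_ext => n /=; rewrite modnMml modnMmr mulnA. Qed.

Lemma mul2C : commutative mul2.
Proof. by move=> x y; apply: Z2adic_ext => n /=; rewrite mulnC. Qed.

Lemma mul21 : left_id (of_nat2 1) mul2.
Proof. by move=> x; apply: Z2adic_ext => n /=; rewrite modnMml mul1n res2_mod. Qed.

Lemma mul2D : left_distributive mul2 add2.
Proof.
by move=> x y z; apply: Z2adic_ext => n /=; rewrite modnMml mulnDl modnDm.
Qed.

Lemma one2_neq0 : of_nat2 1 != of_nat2 0.
Proof. by apply/eqP => /(congr1 (fun x : Z2adic => x 1)). Qed.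

HB.instance Definition _ :=
  GRing.Zmodule_isComNzRing.Build Z2adic mul2A mul2C mul21 mul2D one2_neq0.

Definition unit2 : {pred Z2adic} := fun x => `[< exists y : Z2adic, (y * x = 1)%R >].
Definition inv2 x : Z2adic :=
  if unit2 x then xget x [set y : Z2adic | (y * x = 1)%R] else x.

Lemma mulV2 : {in unit2, left_inverse 1%R inv2 *%R}.
Proof.
by move=> x ux; rewrite /inv2 ifT //; move: ux => /asboolP; apply: xgetPex.
Qed.

Lemma unit2P x y : (y * x = 1)%R -> unit2 x.
Proof. by move=> yx1; apply/asboolP; exists y. Qed.

Lemma inv2_out : {in [predC unit2], inv2 =1 id}.
Proof. by move=> x /negbTE ux; rewrite /inv2 [unit2 x]ux. Qed.

HB.instance Definition _ :=
  GRing.ComNzRing_hasMulInverse.Build Z2adic mulV2 unit2P inv2_out.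

Lemma res2_neq0 x : (x != 0)%R -> exists n, ~~ (2 ^ n %| x n).
Proof.
move=> x0; apply: contrapT => xn; case/eqP: x0; apply: Z2adic_ext => n.
have [dx|ndx] := boolP (2 ^ n %| x n); last by exfalso; apply: xn; exists n.
by rewrite -res2_mod (eqP dx) /= mod0n.
Qed.

Lemma Z2adic_integral : GRing.integral_domain_axiom Z2adic.
Proof.
move=> x y xy0; have [//|/res2_neq0[n xn]] := eqVneq x 0%R.
have [//|/res2_neq0[m ym]] := eqVneq y 0%R; exfalso.
have /dvdnP[q e] : 2 ^ (n + m) %| x (n + m) * y (n + m).
  have : (x * y)%R (n + m) = 0 by rewrite xy0 /= mod0n.
  by move=> /eqP.
have {}xn : ~~ (2 ^ n %| x (n + m)) by rewrite /dvdn res2_modD -res2_mod.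
have {}ym : ~~ (2 ^ m %| y (n + m)) by rewrite /dvdn addnC res2_modD -res2_mod.
have X0 : 0 < x (n + m) by rewrite lt0n; apply: contraNneq xn => ->.
have Y0 : 0 < y (n + m) by rewrite lt0n; apply: contraNneq ym => ->.
have : n + m <= logn 2 (x (n + m) * y (n + m)).
  by rewrite -pfactor_dvdn ?muln_gt0 ?X0 // e dvdn_mull.
rewrite lognM // => h; move: xn ym; rewrite !pfactor_dvdn // -!ltnNge => a b.
have {}a : logn 2 (x (n + m)) + logn 2 (y (n + m)) < n + m.
  by rewrite -addSn leq_add // ltnW.
by rewrite ltnNge h in a.
Qed.

HB.instance Definition _ := GRing.ComUnitRing_isIntegral.Build Z2adic Z2adic_integral.

End Z2adicRing.

Notation Q2adic := {fraction Z2adic}.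

Local Open Scope ring_scope.

Lemma res2_nat (m n : nat) : (m%:R : Z2adic) n = (m %% 2 ^ n)%N.
Proof.
elim: m => [|m IH]; first by rewrite /= mod0n.
rewrite mulrS /= IH.
change ((1 : Z2adic) n) with (1 %% 2 ^ n)%N.
by rewrite modnDm add1n.
Qed.

Lemma res2_sub0 (x y : Z2adic) n : x n = y n -> (x - y) n = 0%N.
Proof.
move=> xy; have E (z : Z2adic) : (z - y) n = ((z n + (- y)%R n) %% 2 ^ n)%N by [].
by rewrite E xy -E subrr /= mod0n.
Qed.

Lemma res2_dvd (x : Z2adic) k : x k = 0%N -> exists y : Z2adic,
  x = 2 ^+ k * y /\ forall m, y m = (x (m + k) %/ 2 ^ k)%N.
Proof.
move=> xk.
have P m : ((x (m.+1 + k) %/ 2 ^ k) %% 2 ^ m = x (m + k) %/ 2 ^ k)%N.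
  by rewrite modn_divl -expnD addSn res2P.
exists (MkZ2adic P); split=> //; apply: Z2adic_ext => m /=.
rewrite -natrX res2_nat modnMml [(2 ^ k * _)%N]mulnC divnK.
  by rewrite res2_modD.
by rewrite /dvdn addnC res2_modD xk.
Qed.

Lemma res2_unit (x : Z2adic) : x 1%N = 1%N -> exists y, y * x = 1.
Proof.
move=> x1.
have odx n : coprime (x n) (2 ^ n).
  case: n => [|n]; first by rewrite coprimen1.
  rewrite coprime_pexpr // coprimen2.
  by have := res2_modD x 1 n; rewrite x1 add1n expn1 modn2; case: odd.
have eul n : (x n ^ (2 ^ n) = 1 %[mod 2 ^ n])%N.
  case: n => [|n]; first by rewrite expn0 !modn1.
  have := Euler_exp_totient (odx n.+1); rewrite totient_pfactor //= mul1n => h.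
  by rewrite [in (_ ^ (2 ^ _))%N]expnS mulnC expnM -modnXm h modnXm exp1n.
have P n : ((x n.+1 ^ (2 ^ n.+1).-1 %% 2 ^ n.+1) %% 2 ^ n
          = x n ^ (2 ^ n).-1 %% 2 ^ n)%N.
  rewrite modn_dvdm ?dvdn_exp2l // -modnXm res2P.
  have -> : ((2 ^ n.+1).-1 = (2 ^ n).-1 + 2 ^ n)%N.
    by have := expn_gt0 2 n; rewrite expnS; lia.
  by rewrite expnD -modnMmr eul modnMmr muln1.
exists (MkZ2adic P); apply: Z2adic_ext => n /=.
by rewrite modnMml -expnSr prednK ?expn_gt0 // eul.
Qed.

Lemma Z2adic_fact (b : Z2adic) : b != 0 -> exists k (w : Z2adic), w * b = 2 ^+ k.
Proof.
move=> b0.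
have ex : exists n, b n != 0%N.
  apply: contrapT => h; case/eqP: b0; apply: Z2adic_ext => n /=.
  by rewrite mod0n; apply/eqP; apply/negPn/negP => bn; apply: h; exists n.
case: (ex_minnP ex) => -[|k] bk mn.
  by rewrite -res2_mod modn1 in bk.
have bk0 : b k = 0%N.
  by apply/eqP; apply/negPn/negP => /mn; rewrite ltnn.
have [y [bE yE]] := res2_dvd bk0.
have [|w wy] := @res2_unit y.
  have ylt : (y 1 < 2)%N by rewrite -(res2_mod y 1) ltn_mod.
  have : y 1%N != 0%N; last by move: ylt; case: (y 1%N) => [|[|]].
  have : (2 ^ k %| b k.+1)%N by rewrite /dvdn res2P bk0.
  by rewrite yE add1n => /divnK e; apply: contraNneq bk => z; rewrite -e z.
by exists k, w; rewrite bE mulrCA wy mulr1.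
Qed.

Lemma Q2adic_frac (u : Q2adic) :
  exists a b : Z2adic, b != 0 /\ u = tofrac a / tofrac b.
Proof.
elim/quotW: u => x; exists (\n_x), (\d_x).
have b0 : \d_x != 0 by exact: denom_ratioP.
split=> //; apply: (canRL (mulfK _)); first by rewrite tofrac_eq0.
unlock tofrac; rewrite -[LHS]FracField.pi_mul; apply/eqmodP.
by rewrite /= FracField.equivfE /FracField.mulf /= !numden_Ratio ?oner_neq0 ?mulr1 // mulrC.
Qed.

Lemma two_neq0 : (2 : Q2adic) != 0.
Proof.
rewrite -[2]/(2%:R) -(rmorph_nat (@tofrac _)) tofrac_eq0.
by apply/eqP => /(congr1 (fun x : Z2adic => x 2%N)); rewrite res2_nat /= mod0n.
Qed.

Lemma Q2adic_fact (u : Q2adic) : exists (k : nat) (a : Z2adic),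
  u = (2 : Q2adic) ^ (- k%:Z) * tofrac a.
Proof.
have [a [b [b0 ->]]] := Q2adic_frac u.
have [k [w wb]] := Z2adic_fact b0.
exists k, (w * a); rewrite -exprnN.
apply: (canLR (mulfK _)); first by rewrite tofrac_eq0.
rewrite -mulrA -tofracM mulrAC wb tofracM tofracXn.
have -> : tofrac (2 : Z2adic) = 2 by rewrite -[2]/(2%:R) rmorph_nat.
by rewrite mulKf // expf_neq0 // two_neq0.
Qed.

Lemma res2_digit (a : Z2adic) m :
  (a m.+1 = a m + odd (a m.+1 %/ 2 ^ m) * 2 ^ m)%N.
Proof.
rewrite {1}(divn_eq (a m.+1) (2 ^ m)) res2P addnC; congr (_ + _ * _)%N.
have : (a m.+1 %/ 2 ^ m < 2)%N.
  by rewrite ltn_divLR ?expn_gt0 // -expnS -(res2_mod a m.+1) ltn_mod expn_gt0.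
by case: (_ %/ _)%N => [|[|]].
Qed.

(* u \in 2^n Z_2, that is v_2(u) >= n (with v_2(0) = +oo). *)
Definition v2_ge (n : int) (u : Q2adic) : Prop :=
  exists a : Z2adic, u = 2 ^ n * tofrac a.

(* c is the sequence of digits of u = \sum_n c_n 2^n. The sums below have
   finite support because of the first clause; n < v_2(u) is v_2(u) >= n + 1,
   and the second clause is convergence of the series to u in Q_2. *)
Definition is_digits2 (u : Q2adic) (c : int -> bool) : Prop :=
  (forall n : int, v2_ge (n + 1) u -> c n = false) /\
  (forall M : int, exists N0 : int, forall N : int, N0 <= N ->
     v2_ge M (u - \sum_(n \in [set n : int | n <= N]) (c n)%:R * (2 : Q2adic) ^ n)).

Lemma v2_ge_leW (m n : int) u : m <= n -> v2_ge n u -> v2_ge m u.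
Proof.
move=> mn [a ->]; have [k ->] : exists k : nat, n = m + k%:Z.
  by exists (absz (n - m)); lia.
exists (2 ^+ k * a); rewrite tofracM tofracXn mulrA.
have -> : tofrac (2 : Z2adic) = 2 by rewrite -[2]/(2%:R) rmorph_nat.
by rewrite expfzDr // two_neq0.
Qed.

Lemma is_digits2_ex (u : Q2adic) : exists c, is_digits2 u c.
Proof.
have [k [a ->]] := Q2adic_fact u.
have two0 := two_neq0.
have tofrac2 : tofrac (2 : Z2adic) = 2 by rewrite -[2]/(2%:R) rmorph_nat.
pose c (n : int) := (0 <= n + k%:Z) &&
  odd (a (absz (n + k%:Z)).+1 %/ 2 ^ (absz (n + k%:Z))).
exists c; split=> [n [b]|M].
  rewrite /c; case: (lerP 0 (n + k%:Z)) => //= nk0.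
  have [m mE] : exists m : nat, n = m%:Z - k%:Z by exists (absz (n + k%:Z)); lia.
  rewrite {}mE in nk0 *; rewrite subrK /=.
  rewrite [_ - _ + 1](_ : _ = - k%:Z + m.+1%:Z); last by lia.
  rewrite expfzDr // -mulrA => /(mulfI _) e; move: (e (expfz_neq0 _ two0)).
  rewrite -exprnP -tofrac2 -tofracXn -tofracM => /eqP; rewrite tofrac_eq => /eqP ->.
  by rewrite /= -natrX res2_nat modnn mul0n mod0n div0n.
have sumE (m : nat) : \sum_(n \in [set n : int | n <= m%:Z - k%:Z - 1])
    (c n)%:R * (2 : Q2adic) ^ n = 2 ^ (- k%:Z) * (a m)%:R.
  rewrite (fsbigE [seq i%:Z - k%:Z | i <- iota 0 m]).
  - rewrite big_map big_mkcond /=.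
    have -> : (a m)%:R = \sum_(0 <= i < m) (odd (a i.+1 %/ 2 ^ i) * 2 ^ i)%:R :> Q2adic.
      elim: m => [|m IH]; last by rewrite big_nat_recr //= -IH {1}res2_digit natrD.
      by rewrite big_geq // -(res2_mod a 0) modn1.
    rewrite mulr_sumr /index_iota subn0 big_seq [RHS]big_seq.
    apply: eq_bigr => i; rewrite mem_iota add0n => /= im.
    rewrite ifT; last by rewrite inE /=; lia.
    rewrite /c subrK /= natrM natrX mulrCA expfzDr // [2 ^ _ * _]mulrC; congr (_ * _).
  - rewrite map_inj_uniq ?iota_uniq // => i j; lia.
  - by move=> z /mapP[i]; rewrite mem_iota => /= im ->; lia.
  - move=> i /= iN iNr; rewrite /c; case: lerP => /= h; last by rewrite mul0r.
    case/negP: iNr; apply/mapP; exists (absz (i + k%:Z)); last by lia.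
    by rewrite mem_iota; lia.
exists (Num.max (- k%:Z) M) => N; rewrite ge_max => /andP[Nk NM].
have [m mE] : exists m : nat, N = m%:Z - k%:Z - 1 by exists (absz (N + k%:Z + 1)); lia.
rewrite mE sumE -mulrBr; apply: (@v2_ge_leW _ (m%:Z - k%:Z)); first by lia.
have [|b [bE _]] := @res2_dvd (a - (a m)%:R) m.
  by apply: res2_sub0; rewrite res2_nat res2_mod.
exists b; rewrite -[(a m)%:R](rmorph_nat (@tofrac _)) -tofracB bE.
by rewrite tofracM tofracXn tofrac2 mulrA -[m%:Z - _]addrC expfzDr.
Qed.

Definition digits2 (u : Q2adic) : int -> bool :=
  xget (fun=> false) [set c | is_digits2 u c].

Lemma digits2P (u : Q2adic) : is_digits2 u (digits2 u).
Proof. exact: (xgetPex _ (is_digits2_ex u)). Qed.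

Definition floor2 (u : Q2adic) : rat :=
  \sum_(n \in [set n : int | n <= 0]) (digits2 u n)%:R * (2 : rat) ^ n.

Definition is_least_argmin (R : realType) (f : int -> R) (m : int) : Prop :=
  (forall j : int, f m <= f j) /\
  (forall i : int, (forall j : int, f i <= f j) -> m <= i).

Lemma is_least_argmin_ex (R : realType) (x q : R) (s : int) : 0 < s ->
  exists m, is_least_argmin (fun i => `|x - (s * i)%:~R - q|) m.
Proof.
move=> s0; pose f (i : int) := `|x - (s * i)%:~R - q|; rewrite -/f.
pose t := (x - q) / s%:~R; pose n := Num.floor t.
have s0R : 0 < s%:~R :> R by rewrite ltr0z.
have fE (i : int) : f i = s%:~R * `|t - i%:~R|.
  rewrite -{1}(gtr0_norm s0R) -normrM /f intrM mulrBr; congr `|_|.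
  by rewrite /t mulrCA divff ?gt_eqF // mulr1; ring.
have n1 : n%:~R <= t by exact: floor_le.
have n2 : t < n%:~R + 1 by have := floorD1_gt t; rewrite intrD.
have lo i : i <= n -> t - n%:~R + (n - i)%:~R <= `|t - i%:~R|.
  by move=> _; rewrite intrB; apply: le_trans (ler_norm _); lra.
have hi i : n < i -> n%:~R + 1 - t + (i - n - 1)%:~R <= `|t - i%:~R|.
  by move=> _; rewrite distrC !intrB; apply: le_trans (ler_norm _); lra.
have fn : `|t - n%:~R| = t - n%:~R by rewrite ger0_norm; lra.
have fn1 : `|t - (n + 1)%:~R| = n%:~R + 1 - t.
  by rewrite intrD distrC ger0_norm; lra.
have le2 : forall i j, (f i <= f j) = (`|t - i%:~R| <= `|t - j%:~R|).
  by move=> i j; rewrite !fE ler_pM2l.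
have [h|h] := lerP (t - n%:~R) (n%:~R + 1 - t).
  exists n; split=> [j|i].
    rewrite le2 fn; case: (lerP j n) => jn.
      by apply: le_trans (lo j jn); rewrite lerDl ler0z; lia.
    apply: le_trans (hi j jn); apply: (le_trans h).
    by rewrite lerDl ler0z; lia.
  move=> /(_ n); rewrite le2 fn => h2; rewrite leNgt; apply/negP => ni.
  have := le_trans (lo i (ltW ni)) h2; rewrite gerDl lerz0; lia.
exists (n + 1); split=> [j|i].
  rewrite le2 fn1; case: (lerP j n) => jn.
    apply: le_trans (lo j jn); apply: (le_trans (ltW h)).
    by rewrite lerDl ler0z; lia.
  by apply: le_trans (hi j jn); rewrite lerDl ler0z; lia.
move=> /(_ (n + 1)); rewrite le2 fn1 => h2; rewrite leNgt; apply/negP => ni.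
have ni' : i <= n by lia.
have := le_trans (lo i ni') h2; have : 0 <= (n - i)%:~R :> R by rewrite ler0z; lia.
lra.
Qed.

Definition least_argmin (R : realType) (f : int -> R) : int :=
  xget 0 [set m | is_least_argmin f m].

Lemma least_argminP (R : realType) (x q : R) (s : int) : 0 < s ->
  let f := fun i => `|x - (s * i)%:~R - q| in is_least_argmin f (least_argmin f).
Proof. by move=> s0; exact: (xgetPex _ (is_least_argmin_ex x q s0)). Qed.

Section Algorithm.
Variables (K : fieldExtType rat) (R : realType).
Variables (sigma_oo : {rmorphism K -> R}) (sigma_2 : {rmorphism K -> Q2adic}).

(* eps = false is b^(0), eps = true is b^(1). *)
Definition bstep (eps : bool) (alpha : K) : rat :=
  let q := floor2 (sigma_2 alpha) in
  let s : int := if eps then 1 else 2 in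
  let m := least_argmin (fun i => `|sigma_oo alpha - (s * i)%:~R - ratr q|) in
  (s * m)%:~R + q.

Definition F2 (eps : bool) (alpha : K) : K := (alpha - ratr (bstep eps alpha))^-1.

Fixpoint alpha_seq (alpha : K) (n : nat) : K :=
  if n is n'.+1 then F2 (odd n') (alpha_seq alpha n') else alpha.

End Algorithm.

(* Main.v *)
(* Write x_n for the complete quotients. If x_n is a root of A x^2 + B x + C
   with coefficients in Z[1/2], then x_{n+1} is a root of a polynomial of the
   same kind, and d = 2 A x + B only changes sign. The quantity E = A x satisfies
   E_{n+1} = - d_n + E_n / (x_n x_{n+1}), and for n >= 1 the product x_n x_{n+1}
   has absolute value at least 2 in R and at least 1 in Q_2. Hence E, and with it
   A and B = d - 2 E, is bounded in both places, and only finitely many pairs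
   (A, B) in Z[1/2]^2 occur. For even n, x_n = (d - B) / (2 A) is determined by
   the pair. *)
Require Import Defs.
From mathcomp Require Import all_boot all_order all_algebra all_field.
From mathcomp Require Import reals.
From mathcomp Require Import zify ring lra.
From mathcomp Require Import boolp classical_sets fsbigop.

Set Implicit Arguments.
Unset Strict Implicit.
Unset Printing Implicit Defensive.

Import Order.TTheory GRing.Theory Num.Theory.

Local Open Scope ring_scope.

(** * The ring Z[1/2] and valuation bounds in Q_2 *)

Definition dyadic (q : rat) : Prop :=
  exists (j : nat) (z : int), q * 2 ^+ j = z%:~R.

Lemma dyadic_int (z : int) : dyadic z%:~R.
Proof. by exists 0%N, z; rewrite mulr1. Qed.

Lemma dyadicD (p q : rat) : dyadic p -> dyadic q -> dyadic (p + q).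
Proof.
move=> [i [y yE]] [j [z zE]]; exists (i + j)%N, (y * 2 ^+ j + z * 2 ^+ i).
by rewrite !(rmorphD, rmorphM, rmorphXn) /= -yE -zE exprD; ring.
Qed.

Lemma dyadicM (p q : rat) : dyadic p -> dyadic q -> dyadic (p * q).
Proof.
move=> [i [y yE]] [j [z zE]]; exists (i + j)%N, (y * z).
by rewrite rmorphM /= -yE -zE exprD; ring.
Qed.

Lemma dyadic_exp2 (n : int) : dyadic (2 ^ n).
Proof.
case: n => n; first by exists 0%N, (2 ^+ n); rewrite rmorphXn mulr1.
by exists n.+1, 1; rewrite NegzE -exprnN mulVf // expf_neq0.
Qed.

Lemma tofrac2 : tofrac (2 : Z2adic) = 2.
Proof. by rewrite -[2]/(2%:R) rmorph_nat. Qed.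

Lemma v2_geD (n : int) (u v : Q2adic) : v2_ge n u -> v2_ge n v -> v2_ge n (u + v).
Proof. by move=> [a ->] [b ->]; exists (a + b); rewrite tofracD mulrDr. Qed.

Lemma v2_geN (n : int) (u : Q2adic) : v2_ge n u -> v2_ge n (- u).
Proof. by move=> [a ->]; exists (- a); rewrite tofracN mulrN. Qed.

Lemma v2_geM (m n : int) (u v : Q2adic) :
  v2_ge m u -> v2_ge n v -> v2_ge (m + n) (u * v).
Proof.
move=> [a ->] [b ->]; exists (a * b).
by rewrite tofracM expfzDr ?two_neq0 // mulrACA.
Qed.

Lemma v2_ge0_int (z : int) : v2_ge 0 z%:~R.
Proof. by exists z%:~R; rewrite mul1r rmorph_int. Qed.

Lemma v2_ge_lower_bound (u : Q2adic) : exists k : nat, v2_ge (- k%:Z) u.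
Proof. by have [k [a ->]] := Q2adic_fact u; exists k, a. Qed.

(** A dyadic number has only powers of 2 in its denominator, so a 2-adic bound alone controls that
    denominator. This makes the pairs (A, B) integral after scaling by 2^k. *)
Lemma dyadic_v2_ge_int (f : {rmorphism rat -> Q2adic}) (k : nat) (q : rat) :
  dyadic q -> v2_ge (- k%:Z) (f q) -> exists z : int, q * 2 ^+ k = z%:~R.
Proof.
move=> [j [z zE]] [a aE].
have f2 n : f (2 ^+ n) = 2 ^+ n by rewrite rmorphXn rmorph_nat.
have e : z%:~R * 2 ^+ k = 2 ^+ j * a :> Z2adic.
  apply/eqP; rewrite -tofrac_eq !tofracM !tofracXn tofrac2 rmorph_int.
  have -> : z%:~R = f (z%:~R) by rewrite rmorph_int.
  rewrite -zE rmorphM f2 aE -exprnN.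
  by rewrite mulrC -mulrA mulVKf 1?mulrC // expf_neq0 // two_neq0.
(* The equation in Z_2 is read modulo 2^j. Since [res2_nat] treats naturals, z is replaced by its
   absolute value and the sign moves to [a]. *)
have d : (2 ^ j %| `|z| * 2 ^ k)%N.
  pose w : Z2adic := `|z|%:R * 2 ^+ k.
  have : w j = 0%N.
    have [b ->] : exists b, w = 2 ^+ j * b.
      rewrite /w; case: (intP z) e => [|n|n] /= e.
      - by exists 0; rewrite mulr0 mul0r.
      - by exists a.
      - exists (- a); rewrite mulrN -e.
        by rewrite rmorphN mulNr opprK.
    by rewrite /= -natrX res2_nat modnn mul0n mod0n.
  by rewrite /w -natrX -natrM res2_nat => /eqP.
have : (2 ^+ j %| z * 2 ^+ k)%Z by rewrite dvdzE abszM !abszX.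
move=> /dvdzP[y yE]; exists y.
have t0 : (2 ^+ j : rat) != 0 by rewrite expf_neq0.
apply: (mulIf t0); rewrite mulrAC zE.
by have := congr1 (fun t : int => t%:~R : rat) yE; rewrite !rmorphM !rmorphXn.
Qed.

(** * Digit sums and the 2-adic floor *)

Lemma fsum_digits (V : zmodType) (F : int -> V) (k m : nat) :
  (forall n : int, n < - k%:Z -> F n = 0) ->
  \sum_(n \in [set n : int | n <= m%:Z - k%:Z - 1]%classic) F n =
  \sum_(0 <= i < m) F (i%:Z - k%:Z).
Proof.
move=> F0; rewrite (fsbigE [seq i%:Z - k%:Z | i <- iota 0 m]).
- rewrite big_map big_mkcond /= /index_iota subn0 big_seq [RHS]big_seq.
  apply: eq_bigr => i; rewrite mem_iota add0n => /= im.
  by rewrite ifT // inE /=; lia.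
- by rewrite map_inj_uniq ?iota_uniq // => i j; lia.
- by move=> z /mapP[i]; rewrite mem_iota => /= im ->; lia.
- move=> i /= iN iNr; apply: F0; rewrite ltNge; apply: contraNN iNr => h.
  apply/mapP; exists (absz (i + k%:Z)); last by lia.
  by rewrite mem_iota; lia.
Qed.

(** Digits vanish below the valuation bound of u, which leaves the k + 1 exponents from -k to 0. *)
Lemma floor2E (u : Q2adic) : exists k : nat,
  (forall n : int, n < - k%:Z -> digits2 u n = false) /\
  floor2 u = \sum_(0 <= i < k.+1) (digits2 u (i%:Z - k%:Z))%:R * 2 ^ (i%:Z - k%:Z).
Proof.
have [k uk] := v2_ge_lower_bound u; have [dz _] := digits2P u.
have c0 (n : int) : n < - k%:Z -> digits2 u n = false.
  by move=> nk; apply: dz; apply: v2_ge_leW uk; lia.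
exists k; split=> //; rewrite /floor2.
rewrite -(@fsum_digits _ (fun n => (digits2 u n)%:R * 2 ^ n)); last first.
  by move=> n /c0 ->; rewrite mul0r.
by have -> : k.+1%:Z - k%:Z - 1 = 0 by lia.
Qed.

Lemma floor2_dyadic (u : Q2adic) : dyadic (floor2 u).
Proof.
have [k [_ ->]] := floor2E u; apply: big_ind => [||i _].
- exact: (dyadic_int 0).
- exact: dyadicD.
- by apply: dyadicM (dyadic_exp2 _); exact: (dyadic_int (digits2 u _)).
Qed.

Lemma sub_floor2_v2_ge0 (f : {rmorphism rat -> Q2adic}) (u : Q2adic) :
  v2_ge 0 (u - f (floor2 u)).
Proof.
have [k [c0 ->]] := floor2E u; have [_ /(_ 0)[N0 hN]] := digits2P u.
set c := digits2 u in c0 hN *.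
have f2 (n : int) : f (2 ^ n) = 2 ^ n.
  by rewrite fmorphXz rmorph_nat.
(* By the convergence clause with M = 0, the partial sum up to [l] equals u modulo Z_2. As [l] is
   nonnegative, it contains the whole floor, and its other terms have positive exponents. *)
pose l := `|N0|%N; have := hN l%:Z; move=> /(_ ltac:(lia)).
have -> : l%:Z = (k.+1 + l)%N%:Z - k%:Z - 1 by lia.
rewrite (@fsum_digits _ (fun n => (c n)%:R * 2 ^ n)); last first.
  by move=> n /c0 ->; rewrite mul0r.
rewrite (@big_cat_nat _ _ _ k.+1) ?leq_addr //= => h.
set T := \sum_(k.+1 <= i < _) _ in h.
have hT : v2_ge 0 T.
  rewrite /T big_nat; apply: big_ind => [||i /andP[ki _]].
  - exact: (v2_ge0_int 0).
  - exact: v2_geD.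
  - rewrite -[0]addr0; apply: v2_geM; first exact: (v2_ge0_int (c _)).
    have -> : i%:Z - k%:Z = (i - k)%N by lia.
    by exists (2 ^+ (i - k)); rewrite mul1r tofracXn tofrac2.
have -> : f (\sum_(0 <= i < k.+1) (c (i%:Z - k%:Z))%:R * 2 ^ (i%:Z - k%:Z)) =
    \sum_(0 <= i < k.+1) (c (i%:Z - k%:Z))%:R * 2 ^ (i%:Z - k%:Z).
  by rewrite rmorph_sum; apply: eq_bigr => i _; rewrite rmorphM rmorph_nat f2.
by have := v2_geD h hT; rewrite opprD addrA subrK.
Qed.

(** * Distance to the nearest candidate, and a pigeonhole for integer pairs *)

Lemma least_argmin_dist (R : realType) (x q : R) (s m : int) : 0 < s ->
  is_least_argmin (fun i => `|x - (s * i)%:~R - q|) m ->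
  `|x - (s * m)%:~R - q| <= s%:~R / 2.
Proof.
(* The minimum is compared with a rounding of (x - q) / s to a nearest integer, whose error of at
   most 1/2 becomes s / 2 after scaling. *)
move=> s0 [+ _] => /(_ (Num.floor ((x - q) / s%:~R + 2^-1)))/le_trans; apply.
set t := (x - q) / s%:~R + _; set n := Num.floor t.
have s0R : 0 < s%:~R :> R by rewrite ltr0z.
have n1 : n%:~R <= t by exact: floor_le.
have n2 : t < n%:~R + 1 by have := floorD1_gt t; rewrite intrD.
have xE : x = (t - 2^-1) * s%:~R + q by rewrite /t; field; rewrite gt_eqF.
by rewrite intrM ler_norml; apply/andP; split; nra.
Qed.

Lemma pigeonhole_int2 (g : nat -> int * int) (M : nat) :
  (forall n, (`|(g n).1| <= M)%N /\ (`|(g n).2| <= M)%N) ->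
  exists i j : nat, (i < j)%N /\ g i = g j.
Proof.
move=> gM; pose T : finType := ('I_(M + M).+1 * 'I_(M + M).+1)%type.
(* After the shift by M the entries lie between 0 and 2M, so [inord] never falls back on its default
   value and loses no information. *)
pose h (i : 'I_(#|T|.+1)) : T :=
  (inord `|(g i).1 + M%:Z|, inord `|(g i).2 + M%:Z|).
have /injectivePn[i [j ij]] : ~~ injectiveb h.
  by apply/injectiveP => /leq_card; rewrite card_ord ltnn.
have hE (a b : int) : (`|a| <= M)%N -> (`|b| <= M)%N ->
    inord `|a + M%:Z| = inord `|b + M%:Z| :> 'I_(M + M).+1 -> a = b.
  by move=> aM bM /(congr1 val) /=; rewrite !inordK; lia.
move=> [/hE e1 /hE e2].
have gij : g i = g j.
  rewrite (surjective_pairing (g i)) (surjective_pairing (g j)).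
  by congr (_, _); [apply: e1|apply: e2]; case: (gM i); case: (gM j).
have [lij|lji|e] := ltngtP i j; first by exists i, j.
  by exists j, i.
by case/eqP: ij; apply: val_inj.
Qed.

(** * Quadratic equations over Z[1/2] and their transformation *)

Section QuadraticIrrationals.
Variables (K : fieldExtType rat).
Implicit Types (x : K) (a b c : rat).

Lemma ratr_in_alg a : ratr a = a%:A :> K.
Proof.
have z0 : (denq a)%:~R != 0 :> K.
  rewrite -(rmorph_int (in_alg K)) fmorph_eq0 intr_eq0; exact: denq_neq0.
rewrite /ratr -[in RHS](divq_num_den a) -[RHS]/(in_alg K _).
by rewrite fmorph_div !rmorph_int.
Qed.

Lemma irrational_lin x a b : x \notin 1%VS -> a%:A * x + b%:A = 0 -> a = 0.
Proof.
move=> xQ e; apply/eqP; apply: contraNT xQ => a0.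
have -> : x = (- b / a)%:A.
  have a0' : a%:A != 0 :> K by rewrite -[_%:A]/(in_alg K a) fmorph_eq0.
  apply: (mulfI a0'); rewrite -[(_ / _)%:A]/(in_alg K _) -[a%:A]/(in_alg K a) -rmorphM /=.
  rewrite mulrCA divff // mulr1 scaleNr; apply/eqP.
  by rewrite -addr_eq0 e.
by rewrite rpredZ // mem1v.
Qed.

Lemma irrational_invB x a : x \notin 1%VS -> (x - a%:A)^-1 \notin 1%VS.
Proof.
move=> xQ; apply: contraNN xQ; rewrite rpredV => h.
by rewrite -[x](subrK a%:A) rpredD // rpredZ // mem1v.
Qed.

Lemma quadratic_int_equation x : \dim {: K} = 2%N -> x \notin 1%VS ->
  exists a b c : int, a != 0 /\
    a%:~R%:A * x ^+ 2 + b%:~R%:A * x + c%:~R%:A = 0.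
Proof.
move=> dimK xQ.
have free_x1 : free [:: x; 1].
  by rewrite free_cons span_seq1 xQ seq1_free oner_neq0.
have b : basis_of fullv [tuple x; 1] by rewrite basisEfree free_x1 subvf dimK.
have := coord_basis b (memvf (x ^+ 2)); rewrite !big_ord_recl big_ord0 addr0 /=.
move: (coord _ _ _) (coord _ _ _) => q p e.
(* The relation x^2 = p x + q is multiplied by both denominators. *)
exists (denq p * denq q), (- (numq p * denq q)), (- (denq p * numq q)).
split; first by rewrite mulf_neq0 ?denq_neq0.
have eK : x ^+ 2 = in_alg K p * x + in_alg K q by rewrite e mulr_algl.
by rewrite -!in_algE eK !(rmorphM, rmorphN) /= !numqE -!in_algE !rmorphM /=; ring.
Qed.

(* [d] is the derivative at [x] of the quadratic polynomial vanishing at [x]. *)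
Definition dyadic_quadratic (d x : K) (a b : rat) : Prop :=
  [/\ dyadic a, dyadic b, 2 * (a%:A * x) + b%:A = d &
      exists2 c, dyadic c & a%:A * x ^+ 2 + b%:A * x + c%:A = 0].

(* The substitution [x = t + 1 / y] preserves the discriminant, that is, the
   square of [d]. *)
Lemma dyadic_quadratic_invB (d x : K) (a b t : rat) :
  dyadic t -> x \notin 1%VS -> dyadic_quadratic d x a b ->
  exists a' b', dyadic_quadratic (- d) (x - t%:A)^-1 a' b' /\
    a'%:A * (x - t%:A)^-1 = - d + a%:A * (x - t%:A).
Proof.
move=> dt xQ [da db dE [c dc root_x]].
(* With P = a X^2 + b X + c these are P(t) and P'(t), because Y^2 P(t + 1/Y) = P(t) Y^2 + P'(t) Y +
   a. *)
exists (a * t ^+ 2 + b * t + c), (2 * a * t + b).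
have y0 : x - t%:A != 0.
  by apply: contraNneq xQ => /subr0_eq ->; rewrite rpredZ // mem1v.
set y := x - t%:A in y0 *; have xE : x = y + t%:A by rewrite subrK.
(* Taylor expansion at the root x, where P'(x) = d: P(t) = P(x - y) = a y^2 - d y. *)
have aE : (a * t ^+ 2 + b * t + c)%:A = y * (a%:A * y - d).
  transitivity (a%:A * t%:A ^+ 2 + b%:A * t%:A + c%:A : K); last first.
    by apply/eqP; rewrite -subr_eq0 -[X in _ == X]root_x -dE xE; apply/eqP; ring.
  by rewrite -!in_algE !(rmorphD, rmorphM).
have bE : (2 * a * t + b)%:A = d - 2 * (a%:A * y).
  by rewrite -dE xE -!in_algE rmorphD !rmorphM rmorph_nat; ring.
have aE' : (a * t ^+ 2 + b * t + c)%:A * y^-1 = - d + a%:A * y.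
  by rewrite aE mulrAC divff // mul1r addrC.
split=> //; split.
- by rewrite expr2; do ![apply: dyadicD|apply: dyadicM].
- by apply: dyadicD => //; do ![apply: dyadicM => //]; exact: (dyadic_int 2).
- by rewrite aE' bE; ring.
- by exists a => //; rewrite [y^-1 ^+ 2]expr2 mulrA aE' bE; field.
Qed.

End QuadraticIrrationals.

(** * Size of the complete quotients and of their equations at both places *)

Section Orbit.
Variables (K : fieldExtType rat) (R : realType).
Variables (sigma_oo : {rmorphism K -> R}) (sigma_2 : {rmorphism K -> Q2adic}).
Implicit Types (x : K) (eps : bool).

Local Notation b := (bstep sigma_oo sigma_2).

Lemma bstep_dyadic eps x : dyadic (b eps x).
Proof. by apply: dyadicD; [exact: dyadic_int | exact: floor2_dyadic]. Qed.

Lemma bstep_v2_ge0 eps x : v2_ge 0 (sigma_2 (x - (b eps x)%:A)).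
Proof.
pose f : {rmorphism rat -> Q2adic} := (sigma_2 \o in_alg K)%FUN.
rewrite rmorphB -[sigma_2 _%:A]/(f _) /bstep rmorphD rmorph_int opprD addrCA addrC.
by apply: v2_geD; [exact: sub_floor2_v2_ge0 | apply: v2_geN; exact: v2_ge0_int].
Qed.

(** Candidates for b are spaced by 2 or by 1, and the closest one lies within half the spacing. *)
Lemma bstep_dist eps x :
  `|sigma_oo (x - (b eps x)%:A)| <= (if eps then 2^-1 else 1).
Proof.
pose s : int := if eps then 1 else 2.
have s0 : 0 < s by rewrite /s; case: (eps).
have := least_argmin_dist s0
  (least_argminP (sigma_oo x) (ratr (floor2 (sigma_2 x))) s0).
have oo_ratr q : sigma_oo q%:A = ratr q.
  exact: (fmorph_eq_rat (sigma_oo \o in_alg K)%FUN).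
rewrite rmorphB oo_ratr.
rewrite /bstep -/s rmorphD rmorph_int opprD addrA => /le_trans; apply.
by rewrite /s {s s0}; case: eps; [rewrite mul1r | rewrite divff ?intr_eq0].
Qed.

Variable alpha : K.
Hypothesis alphaQ : alpha \notin 1%VS.

Local Notation x_ := (alpha_seq sigma_oo sigma_2 alpha).

Lemma alpha_seqS n : x_ n.+1 = (x_ n - (b (odd n) (x_ n))%:A)^-1.
Proof. by rewrite /= /F2 ratr_in_alg. Qed.

Lemma alpha_seq_irrational n : x_ n \notin 1%VS.
Proof. by elim: n => // n IH; rewrite alpha_seqS irrational_invB. Qed.

Lemma alpha_seq_inv_v2_ge0 n : v2_ge 0 (sigma_2 (x_ n.+1)^-1).
Proof. by rewrite alpha_seqS invrK; exact: bstep_v2_ge0. Qed.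

Lemma alpha_seq_inv_le n : `|sigma_oo (x_ n.+1)^-1| <= (if odd n then 2^-1 else 1).
Proof. by rewrite alpha_seqS invrK; exact: bstep_dist. Qed.

(** Consecutive steps have opposite parity, so one factor is at most 1 and the other at most 1/2.
    The alternation of b^(0) and b^(1) thus supplies the contraction. *)
Lemma alpha_seq_inv_mul_le n : `|sigma_oo ((x_ n.+1)^-1 * (x_ n.+2)^-1)| <= 2^-1.
Proof.
rewrite rmorphM normrM.
have := alpha_seq_inv_le n; have := alpha_seq_inv_le n.+1; rewrite /=.
by case: (odd n) => /= h1 h2; apply: le_trans (ler_pM _ _ h2 h1) _;
  rewrite ?normr_ge0 // ?mulr1 ?mul1r.
Qed.

Lemma alpha_seq_neq0 n : x_ n != 0.
Proof. by apply: contraNneq (alpha_seq_irrational n) => ->; rewrite mem0v. Qed.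

Lemma alpha_seq_quadraticS d n A B : dyadic_quadratic d (x_ n) A B ->
  exists A' B', dyadic_quadratic (- d) (x_ n.+1) A' B' /\
    A'%:A * x_ n.+1 = - d + A%:A * (x_ n.+1)^-1.
Proof.
move=> q; rewrite alpha_seqS invrK.
by apply: dyadic_quadratic_invB q; [exact: bstep_dyadic | exact: alpha_seq_irrational].
Qed.

(** Induction on E = A x: each summand of the recursion stays in 2^(-k) Z_2, and in R the factor 1/2
    absorbs the added |d|. It starts at index 1 because 1/x_n is controlled for n >= 1. The bounds
    on d serve later to bound B = d - 2 E. *)
Lemma alpha_seq_bounded_quadratic d A0 B0 : dyadic_quadratic d alpha A0 B0 ->
  exists (k : nat) (M : R), forall n, exists A B,
    [/\ dyadic_quadratic ((-1) ^+ n.+1 * d) (x_ n.+1) A B,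
        v2_ge (- k%:Z) (sigma_2 (A%:A * x_ n.+1)),
        v2_ge (- k%:Z) (sigma_2 d),
        `|sigma_oo (A%:A * x_ n.+1)| <= M & 2 * `|sigma_oo d| <= M].
Proof.
move=> /(alpha_seq_quadraticS (n := 0))[A1 [B1 [q1 _]]].
have [k1 hk1] := v2_ge_lower_bound (sigma_2 (A1%:A * x_ 1)).
have [k2 hk2] := v2_ge_lower_bound (sigma_2 d).
have [k le_k1 le_k2] : exists2 k, (k1 <= k)%N & (k2 <= k)%N.
  by exists (k1 + k2)%N; lia.
(* This M survives the recursion: |d| + M / 2 <= M since 2 |d| <= M. *)
exists k, (Num.max `|sigma_oo (A1%:A * x_ 1)| (2 * `|sigma_oo d|)).
set M := Num.max _ _.
have dk : v2_ge (- k%:Z) (sigma_2 d) by apply: v2_ge_leW hk2; lia.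
have dM : 2 * `|sigma_oo d| <= M by rewrite le_max lexx orbT.
elim=> [|n [A [B [q hk _ hM _]]]].
  exists A1, B1; split=> //; first by rewrite expr1 mulN1r.
    by apply: v2_ge_leW hk1; lia.
  by rewrite le_max lexx.
have [A' [B' [q' AE]]] := alpha_seq_quadraticS q.
(* Writing A as E / x brings in the product of two consecutive inverses. *)
have {}AE : A'%:A * x_ n.+2 =
    - ((-1) ^+ n.+1 * d) + A%:A * x_ n.+1 * ((x_ n.+1)^-1 * (x_ n.+2)^-1).
  by rewrite AE mulrA mulfK // alpha_seq_neq0.
exists A', B'; split=> //.
- by rewrite exprS -mulrA mulN1r.
- rewrite AE rmorphD; apply: v2_geD.
    rewrite rmorphN; apply: v2_geN; rewrite rmorphM rmorphXn rmorphN1 -signr_odd.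
    by case: (odd _); rewrite ?expr1 ?expr0 ?mulN1r ?mul1r //; apply: v2_geN.
  rewrite rmorphM -[- _%:Z]addr0; apply: v2_geM => //.
  by rewrite rmorphM -[0]addr0; apply: v2_geM; exact: alpha_seq_inv_v2_ge0.
- have := alpha_seq_inv_mul_le n; rewrite AE rmorphD => hp.
  apply: le_trans (ler_normD _ _) _.
  rewrite rmorphN normrN rmorphM normrM rmorphXn rmorphN1 normrX normrN1 expr1n mul1r.
  rewrite rmorphM normrM.
  have := ler_pM (normr_ge0 _) (normr_ge0 _) hM hp; lra.
Qed.

End Orbit.

(** * Finiteness of the set of quotients at even indices *)

Theorem corollary3p20 (K : fieldExtType rat) (R : realType)
    (sigma_oo : {rmorphism K -> R}) (sigma_2 : {rmorphism K -> Q2adic})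
    (alpha : K) :
  \dim {: K} = 2%N ->
  alpha \notin 1%VS ->
  exists n1 n2 : nat,
    (n1 < n2)%N /\
    alpha_seq sigma_oo sigma_2 alpha n1 = alpha_seq sigma_oo sigma_2 alpha n2 /\
    n1 = n2 %[mod 2].
Proof.
move=> dimK alphaQ.
have [a [b [c [a0 root_alpha]]]] := quadratic_int_equation dimK alphaQ.
pose d : K := 2 * (a%:~R%:A * alpha) + b%:~R%:A.
have q0 : dyadic_quadratic d alpha a%:~R b%:~R.
  by split=> //; try exact: dyadic_int; exists c%:~R => //; exact: dyadic_int.
have [k [M hM]] := alpha_seq_bounded_quadratic sigma_oo sigma_2 alphaQ q0.
set s := alpha_seq sigma_oo sigma_2 alpha in hM *.
have d0 : d != 0.
  apply: contraNneq a0 => e.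
  have : (2 * a%:~R : rat) = 0.
    apply: (@irrational_lin _ _ _ b%:~R alphaQ); rewrite -e /d.
    by rewrite -!in_algE rmorphM rmorph_nat mulrA.
  by move/eqP; rewrite mulf_eq0 /= intr_eq0.
(* At the indices used below |1/x| <= 1/2, so |A| <= M / 2, and |B| <= |d| + 2 |E| <= 5 M / 2. Thus
   3 M covers both, and 2^k clears the denominators. *)
pose L := Num.bound (2 ^+ k * (3 * M)).
have M0 : 0 <= M.
  by have [A [B [_ _ _ h _]]] := hM 0%N; apply: le_trans h; exact: normr_ge0.
have L0 : 2 ^+ k * (3 * M) < L%:R.
  by apply: archi_boundP; rewrite mulr_ge0 ?exprn_ge0 // mulr_ge0.
pose f : {rmorphism rat -> Q2adic} := (sigma_2 \o in_alg K)%FUN.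
have bound (q : rat) : dyadic q -> v2_ge (- k%:Z) (f q) ->
    `|sigma_oo q%:A| <= 3 * M ->
    exists2 z : int, (`|z| <= L)%N & q * 2 ^+ k = z%:~R.
  move=> dq vq nq; have [z zE] := dyadic_v2_ge_int dq vq; exists z => //.
  have : `|z%:~R : R| <= L%:R.
    apply: le_trans (ltW L0).
    rewrite -(rmorph_int ((sigma_oo \o in_alg K)%FUN)) -zE rmorphM rmorphXn rmorph_nat.
    rewrite normrM normrX normr_nat mulrC ler_pM2l ?exprn_gt0 //.
  by rewrite -intr_norm -[L%:R]/(L%:Z%:~R) ler_int; lia.
(* At the even index 2n + 2 the sign of d is always +, so x = (d - B) / (2 A), scaled by 2^k,
   depends on the integer pair alone. *)
have main n : exists z : int * int,
    [/\ (`|z.1| <= L)%N, (`|z.2| <= L)%N &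
      s n.*2.+2 = (2 ^+ k * d - z.2%:~R) / (2 * z.1%:~R)].
  have [A [B [[dA dB dE [c' _ root_s]] vE vd nE nd]]] := hM n.*2.+1.
  move: dE; rewrite -signr_odd /= negbK odd_double expr0 mul1r => dE.
  have AE : A%:A = A%:A * s n.*2.+2 * (s n.*2.+2)^-1.
    by rewrite mulfK // alpha_seq_neq0.
  have BE : B%:A = d - 2 * (A%:A * s n.*2.+2) by rewrite -dE; ring.
  have [||z1 z1L z1E] := bound A dA.
  - rewrite /f /= AE rmorphM -[- _%:Z]addr0; apply: v2_geM => //.
    exact: alpha_seq_inv_v2_ge0.
  - rewrite AE rmorphM normrM.
    have h : `|sigma_oo (s n.*2.+2)^-1| <= 2^-1.
      by have := alpha_seq_inv_le sigma_oo sigma_2 alpha n.*2.+1;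
        rewrite oddS odd_double.
    have := ler_pM (normr_ge0 _) (normr_ge0 _) nE h; lra.
  have [||z2 z2L z2E] := bound B dB.
  - rewrite /f /= BE rmorphB; apply: v2_geD => //; apply: v2_geN.
    by rewrite -[2]/(1 + 1) mulrDl mul1r rmorphD; apply: v2_geD.
  - rewrite BE rmorphB; apply: le_trans (ler_normB _ _) _.
    by rewrite rmorphM rmorph_nat normrM normr_nat; have := normr_ge0 (sigma_oo d); lra.
  exists (z1, z2); split=> //=.
  have z1K : z1%:~R = A%:A * 2 ^+ k :> K.
    by rewrite -(rmorph_int (in_alg K)) -z1E rmorphM rmorphXn rmorph_nat.
  have z2K : z2%:~R = B%:A * 2 ^+ k :> K.
    by rewrite -(rmorph_int (in_alg K)) -z2E rmorphM rmorphXn rmorph_nat.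
  have two0 : 2 != 0 :> K by rewrite -(rmorph_nat (in_alg K)) fmorph_eq0.
  (* If A were 0, the irrational x would satisfy a linear equation, forcing B = 0 and then d = 0. *)
  have A0 : A%:A != 0 :> K.
    apply: contraNneq d0 => A0; move: dE; rewrite A0 mul0r mulr0 add0r => dB0.
    have B0 : B = 0.
      apply: (irrational_lin (alpha_seq_irrational sigma_oo sigma_2 alphaQ n.*2.+2)).
      by rewrite -[RHS]root_s A0 mul0r add0r.
    by rewrite -dB0 B0 scale0r.
  rewrite z1K z2K -dE; field.
  by rewrite A0 two0 expf_neq0.
have [g gP] := choice main.
have [i [j [ij gij]]] : exists i j, (i < j)%N /\ g i = g j.
  by apply: (@pigeonhole_int2 g L) => n; case: (gP n).
exists i.*2.+2, j.*2.+2; split; first by rewrite !ltnS ltn_double.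
split; last by rewrite !modn2 /= !odd_double.
by case: (gP i) => _ _ ->; case: (gP j) => _ _ ->; rewrite gij.
Qed.
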